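(* Let $\operatorname{Re}(a)>0$, let $b$ be complex, let $w\neq 0$ be complex and let $j\ge 0$ be an integer. Then $$\left.\frac{d^{j}E_{a,b}(z)}{dz^{j}}\right|_{z=w}=w^{-j}\sum_{k=0}^{j}E_{a,b-k}(w)\sum_{m=k}^{j}\binom{m}{k}\frac{\Gamma(2-b)}{\Gamma(2-b-m+k)}\sum_{q=m}^{j}S_{j}^{(q)}\,\mathcal{S}_{q}^{(m)}\,\frac{1}{a^{q}} .$$
   Context: The Mittag-Leffler function is $E_{a,b}(z)=\sum_{k=0}^{\infty}\frac{z^{k}}{\Gamma(b+ak)}$, with $1/\Gamma$ the entire reciprocal Gamma function. $S_{j}^{(q)}$ denotes the (signed) Stirling numbers of the first kind, $x(x-1)\cdots(x-j+1)=\sum_{q=0}^{j}S_j^{(q)}x^q$, and $\mathcal{S}_{q}^{(m)}$ denotes the Stirling numbers of the second kind, $x^{q}=\sum_{m=0}^{q}\mathcal{S}_q^{(m)}x(x-1)\cdots(x-m+1)$. The ratio $\frac{\Gamma(2-b)}{\Gamma(2-b-n)}$ with integer $n\ge0$ is understood as $n!\binom{1-b}{n}=\prod_{i=0}^{n-1}(1-b-i)$. *)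

(* Defs.v *)
From Stdlib Require Import Reals Lra Lia ZArith.
From Coquelicot Require Import Coquelicot.
Open Scope C_scope.

(* [INR] and [IZR] followed by the embedding of the reals in the complex field. *)
Definition NtoC (n : nat) : C := RtoC (INR n).
Definition ZtoC (n : Z) : C := RtoC (IZR n).

(* f 0 * ... * f (n - 1): n factors, whereas [sum_n f n] has n + 1 terms. *)
Fixpoint Cprod (f : nat -> C) (n : nat) : C :=
  match n with
  | O => 1
  | S n' => Cprod f n' * f n'
  end.

(* x (x - 1) ... (x - n + 1).  The ratio Gamma(2-b) / Gamma(2-b-n), understood
   as n! binom(1-b, n), is [falling (1 - b) n]. *)
Definition falling (x : C) (n : nat) : C := Cprod (fun i => x - NtoC i) n.

Definition Cexp (z : C) : C := (exp (Re z) * cos (Im z), exp (Re z) * sin (Im z))%R.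

(* Gauss's formula 1/Gamma(z) = lim_n z (z+1) ... (z+n) / (n! n^z), where
   n^z = exp (z ln n).  The limit exists for every complex z and vanishes at the
   poles of Gamma.  The term n = 0, where [ln 0] is a dummy value, is irrelevant. *)
Definition rGamma_approx (z : C) (n : nat) : C :=
  Cprod (fun i => z + NtoC i) (S n) * Cexp (- (z * RtoC (ln (INR n))))
    / NtoC (fact n).

Definition rGamma (z : C) : C :=
  iota (T := C_CompleteNormedModule)
    (fun l => filterlim (rGamma_approx z) eventually
                (locally (T := C_CompleteNormedModule) l)).

(* [iota] selects the sum, which exists for every z as soon as 0 < Re a. *)
Definition Mittag_Leffler (a b z : C) : C :=
  iota (T := C_CompleteNormedModule)
    (fun l => is_pseries (K := C_AbsRing) (V := C_NormedModule)
                (fun k => rGamma (b + a * NtoC k)) z l).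

(* f has an n-th complex derivative at z, with value l; for n > 0 this includes
   the existence of the lower-order derivatives on a neighbourhood of z. *)
Fixpoint is_C_derive_n (f : C -> C) (n : nat) (z l : C) : Prop :=
  match n with
  | O => f z = l
  | S n' => exists g : C -> C,
      locally (T := C_UniformSpace) z (fun y => is_C_derive_n f n' y (g y)) /\
      is_derive (K := C_AbsRing) (V := C_NormedModule) g z l
  end.

Definition Csum (f : nat -> C) (m n : nat) : C :=
  sum_n_m (G := C_AbelianMonoid) f m n.

(* [s j q] is the number S_j^(q) for q <= j; indices outside this range are
   left unconstrained.  The defining identities determine it uniquely there. *)
Definition is_stirling1 (s : nat -> nat -> Z) : Prop :=
  forall (j : nat) (x : C),
    falling x j = Csum (fun q => ZtoC (s j q) * x ^ q) 0 j.

Definition is_stirling2 (s : nat -> nat -> Z) : Prop :=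
  forall (q : nat) (x : C),
    x ^ q = Csum (fun m => ZtoC (s q m) * falling x m) 0 q.

(* Both predicates are satisfiable, by the usual triangular recurrences. *)
Fixpoint stirling1_rec (j q : nat) : Z :=
  match j, q with
  | O, O => 1
  | O, S _ => 0
  | S j', O => - Z.of_nat j' * stirling1_rec j' 0
  | S j', S q' => stirling1_rec j' q' - Z.of_nat j' * stirling1_rec j' (S q')
  end%Z.

Fixpoint stirling2_rec (q m : nat) : Z :=
  match q, m with
  | O, O => 1
  | O, S _ => 0
  | S q', O => 0
  | S q', S m' => stirling2_rec q' m' + Z.of_nat (S m') * stirling2_rec q' (S m')
  end%Z.

Lemma stirling1_rec_gt (j q : nat) : (j < q)%nat -> stirling1_rec j q = 0%Z.
Proof.
revert q; induction j as [|j IH]; intros [|q] H; simpl; try lia.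
rewrite !IH by lia; lia.
Qed.

Lemma stirling2_rec_gt (q m : nat) : (q < m)%nat -> stirling2_rec q m = 0%Z.
Proof.
revert m; induction q as [|q IH]; intros [|m] H; cbn [stirling2_rec]; try lia.
rewrite !IH by lia; lia.
Qed.

Lemma ZtoC_of_nat (n : nat) : ZtoC (Z.of_nat n) = NtoC n.
Proof. unfold ZtoC, NtoC. now rewrite INR_IZR_INZ. Qed.

Lemma ZtoC_mult (m n : Z) : ZtoC (m * n) = ZtoC m * ZtoC n.
Proof. unfold ZtoC. now rewrite mult_IZR, RtoC_mult. Qed.

Lemma ZtoC_plus (m n : Z) : ZtoC (m + n) = ZtoC m + ZtoC n.
Proof. unfold ZtoC. now rewrite plus_IZR, RtoC_plus. Qed.

Lemma ZtoC_opp (m : Z) : ZtoC (- m) = - ZtoC m.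
Proof. unfold ZtoC. now rewrite opp_IZR, RtoC_opp. Qed.

Lemma Csum_0 (f : nat -> C) : Csum f 0 0 = f O.
Proof. unfold Csum. apply sum_n_n. Qed.

Lemma Csum_last (f : nat -> C) (n : nat) : Csum f 0 (S n) = Csum f 0 n + f (S n).
Proof. unfold Csum. rewrite sum_n_Sm by lia. reflexivity. Qed.

(* The combination occurring in both recurrences, proved with a boundary term so
   that the induction goes through. *)
Lemma Csum_recurrence (t u F c d : nat -> C) (n : nat) :
  t O = d O * u O ->
  (forall k, t (S k) = u k + d (S k) * u (S k)) ->
  (forall k, c k * F k = F (S k) + d k * F k) ->
  Csum (fun k => t k * F k) 0 n =
  Csum (fun k => c k * (u k * F k)) 0 n - u n * F (S n).
Proof.
intros H0 HS HF; induction n as [|n IH].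
- rewrite !Csum_0, H0.
  replace (c O * (u O * F O)) with (u O * (c O * F O)) by ring.
  rewrite HF; ring.
- rewrite !Csum_last, IH, HS.
  replace (c (S n) * (u (S n) * F (S n))) with (u (S n) * (c (S n) * F (S n))) by ring.
  rewrite HF; ring.
Qed.

Lemma Csum_scal (c : C) (f : nat -> C) (n : nat) :
  Csum (fun k => c * f k) 0 n = c * Csum f 0 n.
Proof.
induction n as [|n IH].
- now rewrite !Csum_0.
- rewrite !Csum_last, IH; ring.
Qed.

Lemma is_stirling1_rec : is_stirling1 stirling1_rec.
Proof.
intros j x; induction j as [|j IH].
- rewrite Csum_0; unfold falling, ZtoC; simpl; ring.
- change (falling x (S j)) with (falling x j * (x - NtoC j)).
  rewrite Csum_last.
  rewrite (Csum_recurrence _ (fun q => ZtoC (stirling1_rec j q))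
             (fun q => x ^ q) (fun _ => x - NtoC j) (fun _ => - NtoC j)).
  + rewrite Csum_scal, <- IH; cbn [stirling1_rec].
    rewrite (stirling1_rec_gt j (S j)) by lia.
    replace (stirling1_rec j j - Z.of_nat j * 0)%Z with (stirling1_rec j j) by lia.
    ring.
  + cbn [stirling1_rec].
    now rewrite ZtoC_mult, ZtoC_opp, ZtoC_of_nat.
  + intro k; cbn [stirling1_rec].
    unfold Z.sub; rewrite ZtoC_plus, ZtoC_opp, ZtoC_mult, ZtoC_of_nat; ring.
  + intro k; rewrite Cpow_S; ring.
Qed.

Lemma is_stirling2_rec : is_stirling2 stirling2_rec.
Proof.
intros q x; induction q as [|q IH].
- rewrite Csum_0; unfold falling, ZtoC; simpl; ring.
- rewrite Cpow_S, Csum_last.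
  rewrite (Csum_recurrence _ (fun m => ZtoC (stirling2_rec q m))
             (falling x) (fun _ => x) NtoC).
  + rewrite Csum_scal, <- IH; cbn [stirling2_rec].
    rewrite (stirling2_rec_gt q (S q)) by lia.
    replace (stirling2_rec q q + Z.of_nat (S q) * 0)%Z with (stirling2_rec q q) by lia.
    ring.
  + unfold NtoC, ZtoC; simpl; ring.
  + intro k; cbn [stirling2_rec].
    rewrite ZtoC_plus, ZtoC_mult, ZtoC_of_nat; ring.
  + intro k.
    change (falling x (S k)) with (falling x k * (x - NtoC k)); ring.
Qed.

(* Main.v *)
Require Import Defs.
From Stdlib Require Import Reals Lra Lia ZArith.
From Coquelicot Require Import Coquelicot.
Open Scope C_scope.

(** The theorem is an identity between power series, read off coefficient by
    coefficient.  Write c_k = 1/Gamma(b + a k).  If the series of E_{a,b} may be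
    differentiated termwise, then w^j times the j-th derivative at w is
    the sum of k (k-1) ... (k-j+1) c_k w^k.  Stirling numbers of the first kind
    turn the falling factorial of k into powers k^q = (a k)^q / a^q, those of the
    second kind turn (a k)^q into falling factorials of a k, and the
    Chu-Vandermonde identity applied to a k = (b + a k - 1) + (1 - b) turns these
    into falling factorials of b + a k - 1.  The recurrence
    1/Gamma(z - 1) = (z - 1) / Gamma(z) makes the latter act on c_k by the shift
    of b to b - l ([falling_mult_rGamma]).  Collecting terms
    ([coef_expansion]) gives a combination of the series of E_{a,b-l}(w).

    The analytic part has to justify three things.

    - Gauss's products converge ([rGamma_cv]), because consecutive ones differ by
      a factor 1 + O(1/n^2); the recurrence ([rGamma_pred]) then follows from an
      exact relation between the products for z - 1 and for z.

    - The coefficients c_k decrease faster than any geometric sequence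
      ([entire_coef_Mittag_Leffler]).  The Gauss
      products for z + a and z are compared factor by factor:
      |1 + a/(z+i)|^2 <= exp(2 Re a / (x+i) + O(x/(x+i)^2)) for x = Re z and
      |Im z| = O(x), and summing over i shows that
      1/|Gamma(z + a)| is at most a constant times x^(- Re a) / |Gamma(z)|
      ([rGamma_add_le]).  Along z = b + a k this ratio tends to 0.

    - A complex power series with such coefficients is termwise differentiable
      ([is_derive_Cpseries]), by a second-order bound on
      (z+h)^k - z^k - k h z^(k-1). *)

(** * Limits of complex sequences *)

Definition Ccv (u : nat -> C) (l : C) : Prop :=
  forall eps : R, (0 < eps)%R ->
    exists N : nat, forall n, (N <= n)%nat -> (Cmod (u n - l) < eps)%R.

Lemma Ccv_filterlim (u : nat -> C) (l : C) :
  Ccv u l <-> filterlim u eventually (locally (T := C_CompleteNormedModule) l).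
Proof.
split.
- intro H; apply (filterlim_locally_ball_norm (K := C_AbsRing) (U := C_NormedModule)).
  intros [eps He]; destruct (H eps He) as [N HN]; exists N; intros n Hn.
  exact (HN n Hn).
- intros H eps He.
  apply (proj1 (filterlim_locally_ball_norm (K := C_AbsRing) (U := C_NormedModule) u l))
    with (eps := mkposreal eps He) in H.
  destruct H as [N HN]; exists N; intros n Hn; exact (HN n Hn).
Qed.

Lemma Ccv_unique (u : nat -> C) (l l' : C) : Ccv u l -> Ccv u l' -> l = l'.
Proof.
intros H H'; apply Ccv_filterlim in H, H'.
exact (filterlim_locally_unique (K := C_AbsRing) (V := C_NormedModule) u l l' H H').
Qed.

Lemma Ccv_le (u v : nat -> C) (lu lv : C) (q : R) (N : nat) :
  (0 <= q)%R ->
  (forall n, (N <= n)%nat -> (Cmod (u n) <= q * Cmod (v n))%R) ->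
  Ccv u lu -> Ccv v lv -> (Cmod lu <= q * Cmod lv)%R.
Proof.
intros Hq H Hu Hv; apply Rnot_lt_le; intro Hlt.
set (d := (Cmod lu - q * Cmod lv)%R).
assert (Hd : (0 < d)%R) by (unfold d; lra).
assert (He : (0 < d / (q + 1))%R) by (apply Rdiv_lt_0_compat; lra).
destruct (Hu _ He) as [Nu HNu]; destruct (Hv _ He) as [Nv HNv].
set (n := Nat.max N (Nat.max Nu Nv)).
specialize (H n ltac:(lia)); specialize (HNu n ltac:(lia)); specialize (HNv n ltac:(lia)).
assert (H1 : (Cmod lu <= Cmod (u n) + Cmod (u n - lu))%R).
{ replace lu with (u n + - (u n - lu)) at 1 by ring.
  eapply Rle_trans; [apply Cmod_triangle | rewrite Cmod_opp; lra]. }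
assert (H2 : (Cmod (v n) <= Cmod lv + Cmod (v n - lv))%R).
{ replace (v n) with (lv + (v n - lv)) at 1 by ring; apply Cmod_triangle. }
assert (H3 : (q * Cmod (v n) <= q * (Cmod lv + d / (q + 1)))%R)
  by (apply Rmult_le_compat_l; lra).
assert (H4 : ((q + 1) * (d / (q + 1)) = d)%R) by (field; lra).
unfold d in *; lra.
Qed.

Lemma exp_le_mono (x y : R) : (x <= y)%R -> (exp x <= exp y)%R.
Proof. intros [H | ->]; [left; now apply exp_increasing | right; reflexivity]. Qed.

(** The differences 1/(n+1) - 1/(n+2) stand for a bound O(1/n^2) that telescopes:
    first p stays bounded by |p 1| exp K, then p is Cauchy with modulus
    proportional to 1/n. *)
Lemma Ccv_of_ratio (p : nat -> C) (K : R) :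
  (0 <= K)%R ->
  (forall n, (Cmod (p (S (S n)) - p (S n))
     <= K * (/ INR (S n) - / INR (S (S n))) * Cmod (p (S n)))%R) ->
  exists l, Ccv p l.
Proof.
intros HK H.
assert (Hd : forall n, (0 <= / INR (S n) - / INR (S (S n)))%R).
{ intro n; assert (0 < INR (S n))%R by (apply lt_0_INR; lia).
  assert (/ INR (S (S n)) <= / INR (S n))%R; [|lra].
  apply Rinv_le_contravar; [lra | rewrite (S_INR (S n)); lra]. }
set (M := (Cmod (p 1%nat) * exp K)%R).
assert (HM : forall n, (Cmod (p (S n)) <= M)%R).
{ assert (Hb : forall n, (Cmod (p (S n)) <= Cmod (p 1%nat) * exp (K * (1 - / INR (S n))))%R).
  { induction n as [|n IH].
    - simpl INR; rewrite Rinv_1, Rminus_diag, Rmult_0_r, exp_0; lra.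
    - replace (p (S (S n))) with (p (S n) + (p (S (S n)) - p (S n))) by ring.
      eapply Rle_trans; [apply Cmod_triangle|].
      set (d := (K * (/ INR (S n) - / INR (S (S n))))%R).
      apply Rle_trans with (Cmod (p (S n)) * exp d)%R.
      + specialize (H n); fold d in H.
        pose proof (Cmod_ge_0 (p (S n))).
        pose proof (Rmult_le_compat_l _ _ _ H0 (exp_ineq1_le d)); lra.
      + replace (K * (1 - / INR (S (S n))))%R with (K * (1 - / INR (S n)) + d)%R
          by (unfold d; ring).
        rewrite exp_plus, <- Rmult_assoc.
        apply Rmult_le_compat_r; [left; apply exp_pos | exact IH]. }
  intro n; eapply Rle_trans; [apply Hb|].
  apply Rmult_le_compat_l; [apply Cmod_ge_0|].
  assert (0 < / INR (S n))%R by (apply Rinv_0_lt_compat, lt_0_INR; lia).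
  apply exp_le_mono; nra. }
assert (HM0 : (0 <= M)%R) by (eapply Rle_trans; [apply Cmod_ge_0 | apply (HM O)]).
assert (HC : forall n k, (Cmod (p (S (n + k)) - p (S n))
    <= K * M * (/ INR (S n) - / INR (S (n + k))))%R).
{ intros n k; induction k as [|k IH].
  - rewrite Nat.add_0_r.
    replace (p (S n) - p (S n)) with (RtoC 0) by ring; rewrite Cmod_0; lra.
  - rewrite Nat.add_succ_r.
    replace (p (S (S (n + k))) - p (S n))
      with ((p (S (S (n + k))) - p (S (n + k))) + (p (S (n + k)) - p (S n))) by ring.
    eapply Rle_trans; [apply Cmod_triangle|].
    specialize (H (n + k)%nat); specialize (Hd (n + k)%nat); specialize (HM (n + k)%nat).
    assert (K * (/ INR (S (n + k)) - / INR (S (S (n + k)))) * Cmod (p (S (n + k)))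
      <= K * (/ INR (S (n + k)) - / INR (S (S (n + k)))) * M)%R
      by (apply Rmult_le_compat_l; [apply Rmult_le_pos; lra | lra]).
    lra. }
assert (Hcv : exists l : C_CompleteNormedModule, filterlim p eventually (locally l)).
{ apply (filterlim_locally_cauchy (U := C_CompleteNormedModule)).
  intros [eps He].
  destruct (nfloor_ex (2 * (K * M) / eps)) as [N HN].
  { apply Rmult_le_pos; [nra | left; now apply Rinv_0_lt_compat]. }
  set (e := (K * M * / INR (S N))%R).
  assert (Hlt : (e + e < eps)%R).
  { assert (0 < INR (S N))%R by (apply lt_0_INR; lia).
    apply Rmult_lt_reg_r with (INR (S N)); [assumption|].
    unfold e; replace ((K * M * / INR (S N) + K * M * / INR (S N)) * INR (S N))%R
      with (2 * (K * M))%R by (field; lra).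
    rewrite S_INR; destruct HN as [_ HN].
    apply Rmult_lt_compat_l with (r := eps) in HN; [|assumption].
    replace (eps * (2 * (K * M) / eps))%R with (2 * (K * M))%R in HN by (field; lra).
    lra. }
  assert (Hs : forall n, (S N <= n)%nat -> (Cmod (p n - p (S N)) <= e)%R).
  { intros n Hn; replace n with (S (N + (n - S N)))%nat by lia.
    eapply Rle_trans; [apply HC|].
    unfold e; apply Rmult_le_compat_l; [nra|].
    assert (0 < / INR (S (N + (n - S N))))%R by (apply Rinv_0_lt_compat, lt_0_INR; lia).
    lra. }
  exists (fun n => (S N <= n)%nat); split; [exists (S N); auto|].
  intros u v Hu Hv; apply C_NormedModule_mixin_compat1.
  change (Cmod (p v - p u) < eps)%R.
  replace (p v - p u) with ((p v - p (S N)) + - (p u - p (S N))) by ring.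
  eapply Rle_lt_trans; [apply Cmod_triangle|].
  rewrite Cmod_opp; specialize (Hs u Hu) as Hsu; specialize (Hs v Hv); lra. }
destruct Hcv as [l Hl]; exists l; now apply Ccv_filterlim.
Qed.

(** * The complex exponential near 0 *)

Lemma exp_quadratic (x : R) : (Rabs (exp x - 1 - x) <= x ^ 2 * exp (Rabs x))%R.
Proof.
assert (H1 := exp_ineq1_le x).
assert (H2 := exp_ineq1_le (- x)); rewrite exp_Ropp in H2.
assert (Hp := exp_pos x).
assert (H3 : (exp x * (1 - x) <= 1)%R).
{ apply Rmult_le_compat_l with (r := exp x) in H2; [|lra].
  rewrite Rinv_r in H2 by lra; lra. }
rewrite Rabs_pos_eq by lra.
assert (H4 : (1 <= exp (Rabs x))%R)
  by (pose proof (exp_ineq1_le (Rabs x)); pose proof (Rabs_pos x); lra).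
unfold Rabs in *; destruct (Rcase_abs x); nra.
Qed.

Lemma exp_linear (x : R) : (Rabs (exp x - 1) <= Rabs x * exp (Rabs x))%R.
Proof.
assert (H1 := exp_ineq1_le x).
assert (H2 := exp_ineq1_le (- x)); rewrite exp_Ropp in H2.
assert (Hp := exp_pos x).
assert (H3 : (exp x * (1 - x) <= 1)%R).
{ apply Rmult_le_compat_l with (r := exp x) in H2; [|lra].
  rewrite Rinv_r in H2 by lra; lra. }
assert (H4 : (1 <= exp (Rabs x))%R)
  by (pose proof (exp_ineq1_le (Rabs x)); pose proof (Rabs_pos x); lra).
unfold Rabs at 1; destruct (Rcase_abs (exp x - 1));
unfold Rabs in *; destruct (Rcase_abs x); nra.
Qed.

Lemma Rabs_sin_le (x : R) : (Rabs (sin x) <= Rabs x)%R.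
Proof.
assert (H : forall t, (0 <= t)%R -> (Rabs (sin t) <= t)%R).
{ intros t [Ht | <-]; [|rewrite sin_0, Rabs_R0; lra].
  apply Rabs_le; split; [|left; now apply sin_lt_x].
  destruct (Rle_lt_dec t 1) as [H1|H1]; [|destruct (SIN_bound t); lra].
  assert (0 < sin t)%R by (apply sin_gt_0; pose proof PI2_1; lra); lra. }
destruct (Rle_lt_dec 0 x) as [Hx|Hx].
- rewrite (Rabs_pos_eq x) by assumption; now apply H.
- rewrite <- (Rabs_Ropp (sin x)), <- sin_neg, (Rabs_left x) by assumption.
  apply H; lra.
Qed.

Lemma cos_quadratic (x : R) : (Rabs (cos x - 1) <= x ^ 2 / 2)%R.
Proof.
replace x with (2 * (x / 2))%R at 1 by field.
rewrite cos_2a_sin.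
replace (1 - 2 * sin (x / 2) * sin (x / 2) - 1)%R with (- (2 * (sin (x / 2) * sin (x / 2))))%R by ring.
rewrite Rabs_Ropp, Rabs_mult, Rabs_mult, (Rabs_pos_eq 2) by lra.
pose proof (Rabs_sin_le (x / 2)); pose proof (Rabs_pos (sin (x / 2))).
assert (Rabs (sin (x/2)) * Rabs (sin (x/2)) <= Rabs (x/2) * Rabs (x/2))%R
  by (apply Rmult_le_compat; lra).
rewrite <- (Rabs_mult (x/2)), (Rabs_pos_eq (x/2 * (x/2))) in H1 by nra.
lra.
Qed.

Lemma cos_linear (x : R) : (Rabs (cos x - 1) <= Rabs x)%R.
Proof.
assert (H := cos_quadratic x); destruct (COS_bound x).
destruct (Rle_lt_dec (Rabs x) 2) as [H2|H2].
- eapply Rle_trans; [exact H|].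
  rewrite <- (pow2_abs x); pose proof (Rabs_pos x); nra.
- apply Rle_trans with 2%R; [|lra]; apply Rabs_le; lra.
Qed.

Lemma sin_quadratic (x : R) : (Rabs (sin x - x) <= x ^ 2)%R.
Proof.
destruct (MVT_gen (fun t => sin t - t)%R 0 x (fun t => cos t - 1)%R) as [t [Ht Heq]].
- intros t _; auto_derive; [trivial | ring].
- intros t _; apply continuity_pt_minus; [apply continuity_sin | apply continuity_pt_id].
- rewrite sin_0 in Heq.
  replace (sin x - x)%R with ((cos t - 1) * (x - 0))%R by lra.
  rewrite Rminus_0_r, Rabs_mult, <- (pow2_abs x).
  replace (Rabs x ^ 2)%R with (Rabs x * Rabs x)%R by ring.
  apply Rmult_le_compat_r; [apply Rabs_pos|].
  eapply Rle_trans; [apply cos_linear|].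
  revert Ht; unfold Rmin, Rmax, Rabs; destruct (Rle_dec 0 x);
  destruct (Rcase_abs t); destruct (Rcase_abs x); lra.
Qed.

Lemma Cmod_le_Re_Im (u : C) : (Cmod u <= Rabs (Re u) + Rabs (Im u))%R.
Proof.
pose proof (Rabs_pos (Re u)); pose proof (Rabs_pos (Im u)).
apply Rsqr_incr_0_var; [|lra].
unfold Rsqr; pose proof (Cmod2_alt u) as H1.
rewrite <- (pow2_abs (Re u)), <- (pow2_abs (Im u)) in H1; nra.
Qed.

Lemma im_le_Cmod (u : C) : (Rabs (Im u) <= Cmod u)%R.
Proof. eapply Rle_trans; [apply Rmax_r | exact (Rmax_Cmod u)]. Qed.

(** Re and Im of the remainder split as (e^x - 1 - x) cos y + (1 + x)(cos y - 1)
    and (e^x - 1) sin y + (sin y - y); each of the four terms is at most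
    |u|^2 exp |u|. *)
Lemma Cexp_quadratic (u : C) :
  (Cmod (Cexp u - 1 - u) <= 4 * Cmod u ^ 2 * exp (Cmod u))%R.
Proof.
destruct u as [x y].
assert (Hx := re_le_Cmod (x, y)); assert (Hy := im_le_Cmod (x, y)).
set (m := Cmod (x, y)) in *; simpl Re in Hx; simpl Im in Hy.
assert (Hm : (0 <= m)%R) by apply Cmod_ge_0.
eapply Rle_trans; [apply Cmod_le_Re_Im|].
unfold Cexp; simpl.
replace (exp x * cos y + - (1) + - x)%R
  with ((exp x - 1 - x) * cos y + (1 + x) * (cos y - 1))%R by ring.
replace (exp x * sin y + - 0 + - y)%R
  with ((exp x - 1) * sin y + (sin y - y))%R by ring.
assert (He1 : (1 + m <= exp m)%R) by apply exp_ineq1_le.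
assert (He : (exp (Rabs x) <= exp m)%R) by now apply exp_le_mono.
assert (Hx0 := Rabs_pos x); assert (Hy0 := Rabs_pos y).
assert (Hx2 : (x ^ 2 <= m ^ 2)%R) by (rewrite <- pow2_abs; nra).
assert (Hy2 : (y ^ 2 <= m ^ 2)%R) by (rewrite <- pow2_abs; nra).
assert (A1 : (Rabs ((exp x - 1 - x) * cos y) <= m ^ 2 * exp m)%R).
{ rewrite Rabs_mult.
  assert (Hc : (Rabs (cos y) <= 1)%R) by (apply Rabs_le, COS_bound).
  assert (Hq := exp_quadratic x).
  assert (x ^ 2 * exp (Rabs x) <= m ^ 2 * exp m)%R
    by (apply Rmult_le_compat; try lra; [apply pow2_ge_0 | left; apply exp_pos]).
  pose proof (Rabs_pos (exp x - 1 - x)); pose proof (Rabs_pos (cos y)); nra. }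
assert (A2 : (Rabs ((1 + x) * (cos y - 1)) <= exp m * m ^ 2)%R).
{ rewrite Rabs_mult; apply Rmult_le_compat; try apply Rabs_pos.
  - eapply Rle_trans; [apply Rabs_triang|]; rewrite Rabs_R1; lra.
  - eapply Rle_trans; [apply cos_quadratic|]; pose proof (pow2_ge_0 y); lra. }
assert (A3 : (Rabs ((exp x - 1) * sin y) <= m * exp m * m)%R).
{ rewrite Rabs_mult; apply Rmult_le_compat; try apply Rabs_pos.
  - eapply Rle_trans; [apply exp_linear|].
    apply Rmult_le_compat; try lra; left; apply exp_pos.
  - eapply Rle_trans; [apply Rabs_sin_le | exact Hy]. }
assert (A4 := sin_quadratic y).
pose proof (Rabs_triang ((exp x - 1 - x) * cos y) ((1 + x) * (cos y - 1))).
pose proof (Rabs_triang ((exp x - 1) * sin y) (sin y - y)).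
assert (A5 : (m ^ 2 <= m ^ 2 * exp m)%R) by (pose proof (pow2_ge_0 m); nra).
lra.
Qed.

Lemma Cmod_Cexp (u : C) : Cmod (Cexp u) = exp (Re u).
Proof.
destruct u as [x y]; unfold Cexp, Cmod; simpl.
replace (exp x * cos y * (exp x * cos y * 1) + exp x * sin y * (exp x * sin y * 1))%R
  with (exp x * exp x * (Rsqr (sin y) + Rsqr (cos y)))%R by (unfold Rsqr; ring).
rewrite sin2_cos2, Rmult_1_r, sqrt_square; [reflexivity | left; apply exp_pos].
Qed.

Lemma Cexp_plus (u v : C) : Cexp (u + v) = Cexp u * Cexp v.
Proof.
destruct u as [x y], v as [x' y']; unfold Cexp; simpl.
rewrite exp_plus, cos_plus, sin_plus; unfold Cmult; simpl; f_equal; ring.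
Qed.

(** * The reciprocal Gamma function *)

Lemma INR_pos (n : nat) : (0 < INR (S n))%R.
Proof. apply lt_0_INR; lia. Qed.

Lemma ln_succ_bounds (x : R) :
  (0 < x)%R -> (/ (x + 1) <= ln (x + 1) - ln x <= / x)%R.
Proof.
intro Hx.
assert (H : forall t, (0 < t)%R -> (ln t <= t - 1)%R).
{ intros t Ht; pose proof (exp_ineq1_le (ln t)) as H; rewrite exp_ln in H; lra. }
rewrite <- ln_div by lra.
split.
- specialize (H (x / (x + 1))%R ltac:(apply Rdiv_lt_0_compat; lra)).
  rewrite ln_div in * by lra.
  replace (x / (x + 1) - 1)%R with (- / (x + 1))%R in H by (field; lra); lra.
- specialize (H ((x + 1) / x)%R ltac:(apply Rdiv_lt_0_compat; lra)).
  replace ((x + 1) / x - 1)%R with (/ x)%R in H by (field; lra); exact H.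
Qed.

Lemma rGamma_approx_S (z : C) (n : nat) :
  rGamma_approx z (S (S n)) =
  rGamma_approx z (S n) *
    ((1 + z * RtoC (/ INR (S (S n)))) *
     Cexp (- (z * RtoC (ln (INR (S (S n))) - ln (INR (S n)))))).
Proof.
unfold rGamma_approx.
replace (- (z * RtoC (ln (INR (S (S n))))))
  with (- (z * RtoC (ln (INR (S n)))) +
        - (z * RtoC (ln (INR (S (S n))) - ln (INR (S n)))))
  by (rewrite RtoC_minus; ring).
rewrite Cexp_plus.
change (Cprod (fun i => z + NtoC i) (S (S (S n))))
  with (Cprod (fun i => z + NtoC i) (S (S n)) * (z + NtoC (S (S n)))).
rewrite fact_simpl; unfold NtoC at 2 3 5; rewrite mult_INR, RtoC_mult.
assert (INR (S (S n)) <> 0%R) by (apply not_0_INR; lia).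
rewrite RtoC_inv by assumption.
assert (INR (fact (S n)) <> 0%R) by apply INR_fact_neq_0.
field; repeat split; intro E; apply RtoC_inj in E; contradiction.
Qed.

(** The factor is (1 + z s) exp(- z t) with s = 1/(n+2) and
    t = ln((n+2)/(n+1)).  Its first-order part z (s - t) is O(1/n^2), as is every
    other term of its expansion. *)
Lemma rGamma_step_bound (z : C) : exists K : R, (0 <= K)%R /\
  forall n, (Cmod ((1 + z * RtoC (/ INR (S (S n)))) *
     Cexp (- (z * RtoC (ln (INR (S (S n))) - ln (INR (S n))))) - 1)
   <= K * (/ INR (S n) - / INR (S (S n))))%R.
Proof.
set (r := Cmod z).
assert (Hr : (0 <= r)%R) by apply Cmod_ge_0.
exists (r + 2 * (r * r + 4 * (r * r) * exp r * (1 + r)))%R; split.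
{ pose proof (exp_pos r); assert (0 <= r * r)%R by nra.
  assert (0 <= (r * r) * exp r * (1 + r))%R
    by (apply Rmult_le_pos; [apply Rmult_le_pos; lra | lra]).
  lra. }
intro n.
set (x := INR (S n)); assert (Hx : (1 <= x)%R)
  by (unfold x; rewrite S_INR; pose proof (pos_INR n); lra).
rewrite (S_INR (S n)); fold x.
destruct (ln_succ_bounds x ltac:(lra)) as [H1 H2].
set (t := (ln (x + 1) - ln x)%R) in *.
set (s := (/ (x + 1))%R) in *.
set (d := (/ x - s)%R).
assert (Hs : (0 < s)%R) by (apply Rinv_0_lt_compat; lra).
assert (Hix : (/ x <= 1)%R) by (rewrite <- Rinv_1; apply Rinv_le_contravar; lra).
assert (Ht2 : (t * t <= 2 * d)%R).
{ apply Rle_trans with (/ x * / x)%R; [apply Rmult_le_compat; lra|].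
  unfold d, s; apply Rmult_le_reg_r with (x * x * (x + 1))%R; [nra|].
  replace (/ x * / x * (x * x * (x + 1)))%R with (x + 1)%R by (field; lra).
  replace (2 * (/ x - / (x + 1)) * (x * x * (x + 1)))%R with (2 * x)%R by (field; lra).
  lra. }
set (u := - (z * RtoC t)).
assert (Hu : Cmod u = (r * t)%R).
{ unfold u; rewrite Cmod_opp, Cmod_mult, Cmod_R, Rabs_pos_eq by lra; reflexivity. }
set (q := Cexp u - 1 - u).
assert (Hq : (Cmod q <= 4 * (r * r) * exp r * (t * t))%R).
{ unfold q; eapply Rle_trans; [apply Cexp_quadratic|]; rewrite Hu.
  assert (exp (r * t) <= exp r)%R by (apply exp_le_mono; nra).
  replace (4 * (r * t) ^ 2 * exp (r * t))%R
    with ((4 * (r * r) * (t * t)) * exp (r * t))%R by ring.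
  replace (4 * (r * r) * exp r * (t * t))%R
    with ((4 * (r * r) * (t * t)) * exp r)%R by ring.
  apply Rmult_le_compat_l; [|assumption].
  assert (0 <= r * r)%R by nra; assert (0 <= t * t)%R by nra; nra. }
replace ((1 + z * RtoC s) * Cexp u - 1)
  with (z * RtoC (s - t) + (- (z * z * RtoC (s * t)) + q * (1 + z * RtoC s))).
2: { unfold q, u; rewrite RtoC_minus, RtoC_mult; ring. }
eapply Rle_trans; [apply Cmod_triangle|].
assert (B1 : (Cmod (z * RtoC (s - t)) <= r * d)%R).
{ rewrite Cmod_mult, Cmod_R; apply Rmult_le_compat_l; [exact Hr|].
  rewrite Rabs_left1 by lra; unfold d; lra. }
assert (B2 : (Cmod (- (z * z * RtoC (s * t))) <= r * r * (t * t))%R).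
{ rewrite Cmod_opp, !Cmod_mult, Cmod_R, Rabs_pos_eq by nra.
  apply Rmult_le_compat_l; [nra|]; apply Rmult_le_compat_r; lra. }
assert (B3 : (Cmod (q * (1 + z * RtoC s)) <= 4 * (r * r) * exp r * (t * t) * (1 + r))%R).
{ rewrite Cmod_mult; apply Rmult_le_compat; try apply Cmod_ge_0; [exact Hq|].
  eapply Rle_trans; [apply Cmod_triangle|].
  rewrite Cmod_1, Cmod_mult, Cmod_R, Rabs_pos_eq by lra.
  assert (s <= 1)%R by lra; fold r; nra. }
assert (B4 := Cmod_triangle (- (z * z * RtoC (s * t))) (q * (1 + z * RtoC s))).
set (E := (r * r + 4 * (r * r) * exp r * (1 + r))%R).
assert (HE : (0 <= E)%R).
{ unfold E; pose proof (exp_pos r); assert (0 <= r * r)%R by nra.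
  assert (0 <= (r * r) * exp r * (1 + r))%R
    by (apply Rmult_le_pos; [apply Rmult_le_pos; lra | lra]).
  lra. }
assert (B5 : (E * (t * t) <= E * (2 * d))%R) by now apply Rmult_le_compat_l.
unfold E in *; lra.
Qed.

Lemma rGamma_cv (z : C) : Ccv (rGamma_approx z) (rGamma z).
Proof.
destruct (rGamma_step_bound z) as [K [HK H]].
destruct (Ccv_of_ratio (rGamma_approx z) K HK) as [l Hl].
- intro n; rewrite rGamma_approx_S.
  set (f := (1 + _) * _); specialize (H n); fold f in H.
  replace (rGamma_approx z (S n) * f - rGamma_approx z (S n))
    with ((f - 1) * rGamma_approx z (S n)) by ring.
  rewrite Cmod_mult; apply Rmult_le_compat_r; [apply Cmod_ge_0 | exact H].
- replace (rGamma z) with l; [exact Hl|].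
  symmetry; unfold rGamma.
  apply (iota_filterlim_locally (K := C_AbsRing) (V := C_CompleteNormedModule)).
  now apply Ccv_filterlim.
Qed.

Lemma rGamma_approx_shift (z : C) (n : nat) :
  rGamma_approx (z - 1) (S n) * (z + NtoC (S n)) =
  (z - 1) * NtoC (S n) * rGamma_approx z (S n).
Proof.
unfold rGamma_approx.
assert (HP : forall m, Cprod (fun i => z - 1 + NtoC i) (S m) =
                       (z - 1) * Cprod (fun i => z + NtoC i) m).
{ induction m as [|m IH].
  - unfold NtoC; simpl; ring.
  - change (Cprod (fun i => z - 1 + NtoC i) (S (S m)))
      with (Cprod (fun i => z - 1 + NtoC i) (S m) * (z - 1 + NtoC (S m))).
    change (Cprod (fun i => z + NtoC i) (S m))
      with (Cprod (fun i => z + NtoC i) m * (z + NtoC m)).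
    rewrite IH; unfold NtoC; rewrite S_INR, RtoC_plus; ring. }
rewrite HP.
change (Cprod (fun i => z + NtoC i) (S (S n)))
  with (Cprod (fun i => z + NtoC i) (S n) * (z + NtoC (S n))).
replace (- ((z - 1) * RtoC (ln (INR (S n)))))
  with (RtoC (ln (INR (S n))) + - (z * RtoC (ln (INR (S n))))) by ring.
rewrite Cexp_plus.
replace (Cexp (RtoC (ln (INR (S n))))) with (NtoC (S n)).
- unfold Cdiv; ring.
- unfold Cexp, NtoC; simpl Re; simpl Im; rewrite exp_ln by apply INR_pos.
  rewrite cos_0, sin_0, Rmult_1_r, Rmult_0_r; reflexivity.
Qed.

(** The factor z + n on the left of [rGamma_approx_shift] differs from the factor n
    on the right by a relative error |z|/n, which disappears in the limit because
    the approximants at z - 1 are bounded. *)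
Lemma rGamma_pred (z : C) : rGamma (z - 1) = (z - 1) * rGamma z.
Proof.
apply (Ccv_unique (rGamma_approx (z - 1))); [apply rGamma_cv|].
destruct (filterlim_bounded (K := C_AbsRing) (V := C_NormedModule) (rGamma_approx (z - 1)))
  as [M HM].
{ exists (rGamma (z - 1)); apply Ccv_filterlim, rGamma_cv. }
assert (HM' : forall n, (Cmod (rGamma_approx (z - 1) n) <= M)%R) by exact HM.
assert (HM0 : (0 <= M)%R) by (eapply Rle_trans; [apply Cmod_ge_0 | apply (HM' O)]).
intros eps He.
set (r := Cmod (z - 1)); assert (Hr : (0 <= r)%R) by apply Cmod_ge_0.
set (rz := Cmod z); assert (Hrz : (0 <= rz)%R) by apply Cmod_ge_0.
destruct (rGamma_cv z (eps / (2 * (r + 1)))%R) as [N1 HN1].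
{ apply Rdiv_lt_0_compat; lra. }
destruct (nfloor_ex (2 * (rz * M) / eps)) as [N2 [_ HN2]].
{ apply Rmult_le_pos; [nra | left; now apply Rinv_0_lt_compat]. }
exists (S (Nat.max N1 N2)); intros [|n] Hn; [lia|].
specialize (HN1 (S n) ltac:(lia)).
set (p' := rGamma_approx (z - 1) (S n)); set (p := rGamma_approx z (S n)) in *.
set (x := INR (S n)).
assert (Hx : (0 < x)%R) by apply INR_pos.
assert (Hx0 : RtoC x <> 0) by (intro E; apply RtoC_inj in E; lra).
replace (p' - (z - 1) * rGamma z) with ((z - 1) * (p - rGamma z) + - (z * p' * RtoC (/ x))).
2: { pose proof (rGamma_approx_shift z n) as H; fold p' p in H.
     unfold NtoC in H; fold x in H; rewrite RtoC_inv by lra.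
     replace ((z - 1) * (p - rGamma z)) with ((z - 1) * RtoC x * p * / RtoC x - (z - 1) * rGamma z)
       by (field; exact Hx0).
     rewrite <- H; field; exact Hx0. }
eapply Rle_lt_trans; [apply Cmod_triangle|].
rewrite Cmod_opp, !Cmod_mult, Cmod_R, (Rabs_pos_eq (/ x)) by (left; now apply Rinv_0_lt_compat).
fold r rz.
assert (B1 : (r * Cmod (p - rGamma z) <= eps / 2)%R).
{ apply Rle_trans with ((r + 1) * (eps / (2 * (r + 1))))%R.
  - apply Rmult_le_compat; try lra; apply Cmod_ge_0.
  - right; field; lra. }
assert (B2 : (rz * Cmod p' * / x < eps / 2)%R).
{ apply Rle_lt_trans with (rz * M * / x)%R.
  - apply Rmult_le_compat_r; [left; now apply Rinv_0_lt_compat|].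
    apply Rmult_le_compat_l; [lra | apply HM'].
  - apply Rmult_lt_reg_r with x; [exact Hx|].
    replace (rz * M * / x * x)%R with (rz * M)%R by (field; lra).
    assert (INR N2 + 1 <= x)%R by (unfold x; rewrite <- S_INR; apply le_INR; lia).
    apply Rmult_lt_compat_l with (r := eps) in HN2; [|exact He].
    replace (eps * (2 * (rz * M) / eps))%R with (2 * (rz * M))%R in HN2 by (field; lra).
    nra. }
lra.
Qed.

(** This is |1 + u|^2 = 1 + 2 Re u + |u|^2 <= exp(2 Re u + |u|^2) for u = a / z,
    with denominators |z|^2 weakened to (Re z)^2.  The term linear in Re a is kept
    exact, since its sum over z, z + 1, ... produces the decay. *)
Lemma Cmod2_add_le (z a : C) :
  (0 < Re z)%R -> (0 < Re a)%R ->
  (Cmod (z + a) ^ 2 <= Cmod z ^ 2 *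
     exp (2 * Re a * / Re z + (2 * Rabs (Im a) * Rabs (Im z) + Cmod a ^ 2) * (/ Re z) ^ 2))%R.
Proof.
intros Hz Ha.
rewrite !Cmod2_alt, re_plus, im_plus.
set (X := Re z) in *; set (y := Im z); set (al := Re a) in *; set (be := Im a).
set (D := (2 * Rabs be * Rabs y + (al ^ 2 + be ^ 2))%R).
assert (HD : (0 <= D)%R).
{ unfold D; pose proof (Rabs_pos be); pose proof (Rabs_pos y);
  pose proof (pow2_ge_0 al); pose proof (pow2_ge_0 be); nra. }
set (t := (2 * al * / X + D * (/ X) ^ 2)%R).
assert (HX : (0 < / X)%R) by now apply Rinv_0_lt_compat.
assert (Ht : (0 <= t)%R) by (unfold t; pose proof (pow2_ge_0 (/ X)); nra).
apply Rle_trans with ((X ^ 2 + y ^ 2) * (1 + t))%R.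
- assert (E : (X ^ 2 * t = 2 * al * X + D)%R) by (unfold t; field; lra).
  assert (0 <= y ^ 2 * t)%R by (pose proof (pow2_ge_0 y); nra).
  assert (be * y <= Rabs be * Rabs y)%R by (rewrite <- Rabs_mult; apply Rle_abs).
  unfold D in E; nra.
- apply Rmult_le_compat_l; [nra | apply exp_ineq1_le].
Qed.

(** The sums of 1/(x+i) and 1/(x+i)^2 over i <= n are bounded by telescoping:
    apart from the term i = 0, they are compared with differences of ln and of
    1/x. *)
Lemma Cprod_add_le (z a : C) (n : nat) :
  (0 < Re z)%R -> (0 < Re a)%R ->
  (Cmod (Cprod (fun i => (z + a) + NtoC i)%C (S n)) ^ 2 <=
   Cmod (Cprod (fun i => z + NtoC i)%C (S n)) ^ 2 *
     exp (2 * Re a * (/ Re z + (ln (Re z + INR n) - ln (Re z)))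
          + (2 * Rabs (Im a) * Rabs (Im z) + Cmod a ^ 2)
            * ((/ Re z) ^ 2 + (/ Re z - / (Re z + INR n)))))%R.
Proof.
intros Hz Ha.
set (D := (2 * Rabs (Im a) * Rabs (Im z) + Cmod a ^ 2)%R).
assert (HD : (0 <= D)%R).
{ unfold D; pose proof (Rabs_pos (Im a)); pose proof (Rabs_pos (Im z));
  pose proof (pow2_ge_0 (Cmod a)); nra. }
set (x := Re z) in *.
induction n as [|n IH].
- simpl Cprod; simpl INR; rewrite Rplus_0_r, !Rminus_diag, !Rplus_0_r.
  replace (1 * (z + a + NtoC 0)) with (z + a) by (unfold NtoC; simpl; ring).
  replace (1 * (z + NtoC 0)) with z by (unfold NtoC; simpl; ring).
  now apply Cmod2_add_le.
- change (Cprod (fun i => z + a + NtoC i)%C (S (S n)))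
    with (Cprod (fun i => z + a + NtoC i)%C (S n) * (z + a + NtoC (S n))).
  change (Cprod (fun i => z + NtoC i)%C (S (S n)))
    with (Cprod (fun i => z + NtoC i)%C (S n) * (z + NtoC (S n))).
  rewrite !Cmod_mult, !Rpow_mult_distr.
  set (P := (Cmod (Cprod (fun i => z + a + NtoC i)%C (S n)) ^ 2)%R) in *.
  set (Q := (Cmod (Cprod (fun i => z + NtoC i)%C (S n)) ^ 2)%R) in *.
  assert (HQ : (0 <= Q)%R) by apply pow2_ge_0.
  assert (Hn := pos_INR n).
  assert (HX : Re (z + NtoC (S n)) = (x + INR n + 1)%R).
  { rewrite re_plus; change (Re (NtoC (S n))) with (INR (S n)); rewrite S_INR; fold x; ring. }
  assert (HI : Im (z + NtoC (S n)) = Im z).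
  { rewrite im_plus; change (Im (NtoC (S n))) with 0%R; ring. }
  pose proof (Cmod2_add_le (z + NtoC (S n)) a) as H.
  rewrite HX, HI in H; fold D in H; specialize (H ltac:(lra) Ha).
  replace (z + NtoC (S n) + a) with (z + a + NtoC (S n)) in H by ring.
  set (U := (Cmod (z + NtoC (S n)) ^ 2)%R) in *.
  assert (HU : (0 <= U)%R) by apply pow2_ge_0.
  set (e := (2 * Re a * (/ x + (ln (x + INR n) - ln x)) +
             D * ((/ x) ^ 2 + (/ x - / (x + INR n))))%R) in IH.
  set (t := (2 * Re a * / (x + INR n + 1) + D * (/ (x + INR n + 1)) ^ 2)%R) in H.
  apply Rle_trans with ((Q * exp e) * (U * exp t))%R.
  + apply Rmult_le_compat; try apply pow2_ge_0; assumption.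
  + replace (Q * exp e * (U * exp t))%R with (Q * U * exp (e + t))%R
      by (rewrite exp_plus; ring).
    apply Rmult_le_compat_l; [now apply Rmult_le_pos|].
    destruct (ln_succ_bounds (x + INR n) ltac:(lra)) as [HL _].
    replace (x + INR (S n))%R with (x + INR n + 1)%R by (rewrite S_INR; ring).
    set (X := (x + INR n)%R) in *.
    assert (HX0 : (0 < X)%R) by (unfold X; lra).
    assert (HT : ((/ (X + 1)) ^ 2 <= / X - / (X + 1))%R).
    { apply Rmult_le_reg_r with (X * (X + 1) ^ 2)%R; [nra|].
      replace ((/ (X + 1)) ^ 2 * (X * (X + 1) ^ 2))%R with X by (field; lra).
      replace ((/ X - / (X + 1)) * (X * (X + 1) ^ 2))%R with (X + 1)%R by (field; lra).
      lra. }
    apply Rmult_le_compat_l with (r := D) in HT; [|exact HD].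
    apply Rmult_le_compat_l with (r := (2 * Re a)%R) in HL; [|lra].
    apply exp_le_mono; unfold e, t; lra.
Qed.

(** The growth n^(Re a) of the quotient of the products of [Cprod_add_le] cancels
    against n^(-a), since ln(x + n) <= ln 2 + ln n once n >= x; what remains is
    a constant times x^(- Re a).  The condition on Im z keeps z in a sector, where
    the second-order terms contribute O(1). *)
Lemma rGamma_add_le (z a : C) (c : R) :
  (0 < Re a)%R -> (1 <= Re z)%R -> (Rabs (Im z) <= c * Re z)%R ->
  (Cmod (rGamma (z + a)) <=
   exp (Re a * (1 + ln 2 - ln (Re z)) + (2 * Rabs (Im a) * c + Cmod a ^ 2))
   * Cmod (rGamma z))%R.
Proof.
intros Ha Hz Hc.
set (x := Re z) in *.
set (D := (2 * Rabs (Im a) * c + Cmod a ^ 2)%R).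
set (q := (Re a * (1 + ln 2 - ln x) + D)%R).
destruct (nfloor_ex x ltac:(lra)) as [N [_ HN]].
apply Ccv_le with (u := rGamma_approx (z + a)) (v := rGamma_approx z) (N := S N);
  [left; apply exp_pos | | apply rGamma_cv | apply rGamma_cv].
intros n Hn.
assert (Hxn : (x <= INR n)%R).
{ apply Rle_trans with (INR (S N)); [rewrite S_INR; lra | now apply le_INR]. }
apply Rsqr_incr_0_var.
2: { apply Rmult_le_pos; [left; apply exp_pos | apply Cmod_ge_0]. }
rewrite !Rsqr_pow2, Rpow_mult_distr.
unfold rGamma_approx, Cdiv; rewrite !Cmod_mult, !Rpow_mult_distr, !Cmod_Cexp.
pose proof (Cprod_add_le z a n ltac:(fold x; lra) Ha) as H; fold x in H.
set (P := (Cmod (Cprod (fun i => z + a + NtoC i)%C (S n)) ^ 2)%R) in *.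
set (Q := (Cmod (Cprod (fun i => z + NtoC i)%C (S n)) ^ 2)%R) in *.
set (F := (Cmod (/ NtoC (fact n)) ^ 2)%R).
set (L := ln (INR n)).
assert (HE1 : Re (- ((z + a) * RtoC L)) = (- x * L - Re a * L)%R)
  by (rewrite re_opp, re_scal_r, re_plus; fold x; ring).
assert (HE2 : Re (- (z * RtoC L)) = (- x * L)%R)
  by (rewrite re_opp, re_scal_r; fold x; ring).
rewrite HE1, HE2.
rewrite <- Rmult_assoc; apply Rmult_le_compat_r; [apply pow2_ge_0|].
set (e := (2 * Re a * _ + _)%R) in H.
assert (HQ : (0 <= Q)%R) by apply pow2_ge_0.
assert (Hexp : forall t, (exp t ^ 2 = exp (2 * t))%R).
{ intro t; replace (2 * t)%R with (t + t)%R by ring; rewrite exp_plus; ring. }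
rewrite !Hexp.
apply Rle_trans with (Q * exp e * exp (2 * (- x * L - Re a * L)))%R.
{ apply Rmult_le_compat_r; [left; apply exp_pos | exact H]. }
replace (exp (2 * q) * (Q * exp (2 * (- x * L))))%R
  with (Q * (exp (2 * q) * exp (2 * (- x * L))))%R by ring.
rewrite Rmult_assoc, <- !exp_plus.
apply Rmult_le_compat_l; [exact HQ|].
apply exp_le_mono.
assert (Hix : (0 < / x <= 1)%R).
{ split; [apply Rinv_0_lt_compat; lra|].
  rewrite <- Rinv_1; apply Rinv_le_contravar; lra. }
assert (Hln : (ln (x + INR n) <= ln 2 + L)%R).
{ unfold L; rewrite <- ln_mult by lra; apply ln_le; lra. }
set (D' := (2 * Rabs (Im a) * Rabs (Im z) + Cmod a ^ 2)%R) in e.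
assert (HD' : (0 <= D' <= D * x)%R).
{ unfold D', D; pose proof (Rabs_pos (Im a)); pose proof (Rabs_pos (Im z));
  pose proof (pow2_ge_0 (Cmod a)); split; [nra|].
  assert (Rabs (Im a) * Rabs (Im z) <= Rabs (Im a) * (c * x))%R
    by now apply Rmult_le_compat_l.
  nra. }
assert (HS : (D' * ((/ x) ^ 2 + (/ x - / (x + INR n))) <= 2 * D)%R).
{ apply Rle_trans with (D * x * (2 * / x))%R.
  - apply Rmult_le_compat; try lra.
    + assert (/ (x + INR n) <= / x)%R
        by (apply Rinv_le_contravar; [lra | pose proof (pos_INR n); lra]).
      pose proof (pow2_ge_0 (/ x)); lra.
    + assert (0 < / (x + INR n))%R by (apply Rinv_0_lt_compat; lra).
      nra.
  - right; field; lra. }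
assert (HA : (2 * Re a * (/ x + (ln (x + INR n) - ln x))
              <= 2 * Re a * (1 + (ln 2 + L - ln x)))%R)
  by (apply Rmult_le_compat_l; lra).
unfold e, q; lra.
Qed.

(** * Complex power series with infinite radius of convergence *)

Definition Cseries (u : nat -> C) (l : C) : Prop :=
  is_series (K := C_AbsRing) (V := C_NormedModule) u l.

(** [Mittag_Leffler a b] is convertible to an instance of this. *)
Definition Cpseries (c : nat -> C) (z : C) : C :=
  iota (T := C_CompleteNormedModule)
    (fun l => is_pseries (K := C_AbsRing) (V := C_NormedModule) c z l).

(** By Cauchy's estimates and the root test, these are exactly the coefficient
    sequences of entire functions. *)
Definition entire_coef (c : nat -> C) : Prop :=
  forall r : R, (0 <= r)%R -> exists M : R, forall k, (Cmod (c k) * r ^ k <= M)%R.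

Lemma Cseries_unique (u : nat -> C) (l l' : C) : Cseries u l -> Cseries u l' -> l = l'.
Proof.
intros H H'.
exact (filterlim_locally_unique (K := C_AbsRing) (V := C_NormedModule) _ l l' H H').
Qed.

Lemma Cseries_ext (u v : nat -> C) (l : C) :
  (forall k, u k = v k) -> Cseries u l -> Cseries v l.
Proof. exact (is_series_ext (K := C_AbsRing) (V := C_NormedModule) u v l). Qed.

Lemma Cseries_plus (u v : nat -> C) (l l' : C) :
  Cseries u l -> Cseries v l' -> Cseries (fun k => u k + v k) (l + l').
Proof. exact (is_series_plus (K := C_AbsRing) (V := C_NormedModule) u v l l'). Qed.

Lemma Cseries_scal (a : C) (u : nat -> C) (l : C) :
  Cseries u l -> Cseries (fun k => a * u k) (a * l).
Proof. exact (is_series_scal (K := C_AbsRing) (V := C_NormedModule) a u l). Qed.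

Lemma Cseries_Csum (u : nat -> nat -> C) (l : nat -> C) (n : nat) :
  (forall i, Cseries (u i) (l i)) ->
  Cseries (fun k => Csum (fun i => u i k) 0 n) (Csum l 0 n).
Proof.
intro H; induction n as [|n IH].
- rewrite Csum_0; apply Cseries_ext with (u O); [|apply H].
  intro k; now rewrite Csum_0.
- rewrite Csum_last.
  apply Cseries_ext with (fun k => Csum (fun i => u i k) 0 n + u (S n) k).
  + intro k; now rewrite Csum_last.
  + now apply Cseries_plus.
Qed.

Lemma sum_half_pow_le (n : nat) : (sum_n (fun k => (/ 2) ^ k)%R n <= 2)%R.
Proof.
assert (H : (sum_n (fun k => (/ 2) ^ k)%R n = 2 - (/ 2) ^ n)%R).
{ induction n as [|n IH].
  - rewrite sum_O; simpl; lra.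
  - rewrite sum_Sn, IH; unfold plus; simpl; field. }
rewrite H; assert (0 < (/ 2) ^ n)%R by (apply pow_lt; lra); lra.
Qed.

Lemma Cseries_dominated (u : nat -> C) (B : R) :
  (forall k, (Cmod (u k) <= B * (/ 2) ^ k)%R) ->
  exists l, Cseries u l /\ (Cmod l <= 2 * B)%R.
Proof.
intro H.
assert (HB : (0 <= B)%R).
{ specialize (H O); simpl in H; pose proof (Cmod_ge_0 (u O)); lra. }
destruct (ex_series_le (K := C_AbsRing) (V := C_CompleteNormedModule) u
            (fun k => B * (/ 2) ^ k)%R H) as [l Hl].
{ apply (ex_series_scal (K := R_AbsRing) (V := R_NormedModule) B).
  apply ex_series_geom; rewrite Rabs_pos_eq; lra. }
exists l; split; [exact Hl|].
assert (Hcv : Ccv (sum_n u) l) by now apply Ccv_filterlim.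
replace (2 * B)%R with (2 * B * Cmod 1)%R by (rewrite Cmod_1; ring).
apply (Ccv_le (sum_n u) (fun _ => 1) l 1 (2 * B) 0); [lra | | exact Hcv |].
- intros n _; rewrite Cmod_1, Rmult_1_r.
  eapply Rle_trans.
  { apply (norm_sum_n_m (K := C_AbsRing) (V := C_NormedModule) u 0 n). }
  eapply Rle_trans; [apply sum_n_m_le; exact H|].
  eapply Rle_trans; [right; exact (sum_n_m_mult_l (K := R_Ring) B (fun k => (/ 2) ^ k)%R 0 n)|].
  change (B * sum_n (fun k => (/ 2) ^ k)%R n <= 2 * B)%R.
  pose proof (sum_half_pow_le n); nra.
- intros eps He; exists O; intros n _.
  replace (1 - 1) with (RtoC 0) by ring; now rewrite Cmod_0.
Qed.

Lemma Cpseries_unique (c : nat -> C) (z l : C) :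
  Cseries (fun k => c k * z ^ k) l -> Cpseries c z = l.
Proof.
intro H; unfold Cpseries.
assert (Hl : is_pseries (K := C_AbsRing) (V := C_NormedModule) c z l).
{ unfold is_pseries; apply Cseries_ext with (fun k => c k * z ^ k); [|exact H].
  intro k; exact (Cmult_comm (c k) (z ^ k)). }
apply (iota_unique (K := C_AbsRing) (V := C_CompleteNormedModule)); [|exact Hl].
intros y Hy; exact (Cseries_unique _ y l Hy Hl).
Qed.

Lemma Cpseries_correct (c : nat -> C) (z : C) :
  entire_coef c -> Cseries (fun k => c k * z ^ k) (Cpseries c z).
Proof.
intro Hc.
destruct (Hc (2 * Cmod z)%R) as [M HM]; [pose proof (Cmod_ge_0 z); lra|].
destruct (Cseries_dominated (fun k => c k * z ^ k) M) as [l [Hl _]].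
- intro k; specialize (HM k); rewrite Cmod_mult, Cmod_pow.
  replace (Cmod (c k) * Cmod z ^ k)%R with (Cmod (c k) * (2 * Cmod z) ^ k * (/ 2) ^ k)%R.
  + apply Rmult_le_compat_r; [apply pow_le; lra | exact HM].
  + rewrite Rpow_mult_distr, pow_inv by lra; field; apply pow_nonzero; lra.
- now rewrite (Cpseries_unique c z l Hl).
Qed.

Lemma INR_le_pow2 (k : nat) : (INR k <= 2 ^ k)%R.
Proof.
induction k as [|k IH]; [simpl; lra|].
rewrite S_INR; simpl; pose proof (pow_R1_Rle 2 k ltac:(lra)); lra.
Qed.

Lemma entire_coef_derive (c : nat -> C) :
  entire_coef c -> entire_coef (fun k => NtoC (S k) * c (S k)).
Proof.
intros Hc r Hr.
destruct (Hc (2 * (r + 1))%R ltac:(lra)) as [M HM]; exists M; intro k.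
eapply Rle_trans; [|apply (HM (S k))].
rewrite Cmod_mult; unfold NtoC; rewrite Cmod_R, Rabs_pos_eq by apply pos_INR.
rewrite Rpow_mult_distr.
replace (INR (S k) * Cmod (c (S k)) * r ^ k)%R
  with (Cmod (c (S k)) * (INR (S k) * r ^ k))%R by ring.
apply Rmult_le_compat_l; [apply Cmod_ge_0|].
apply Rmult_le_compat; [apply pos_INR | now apply pow_le | apply INR_le_pow2 |].
apply Rle_trans with ((r + 1) ^ k)%R; [apply pow_incr; lra|].
simpl; pose proof (pow_le (r + 1) k ltac:(lra)); nra.
Qed.

(** With e_k the left-hand side for exponent k, e_(k+1) = (z + h) e_k + k h^2 z^(k-1),
    and |z + h| <= |z| + 1. *)
Lemma pow_taylor_le (z h : C) (k : nat) : (Cmod h <= 1)%R ->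
  (Cmod ((z + h) ^ S k - z ^ S k - h * (NtoC (S k) * z ^ k))
   <= Cmod h ^ 2 * (INR (S k) ^ 2 * (Cmod z + 1) ^ S k))%R.
Proof.
intro Hh.
set (r := (Cmod z + 1)%R).
assert (Hz := Cmod_ge_0 z); assert (Hh0 := Cmod_ge_0 h).
induction k as [|k IH].
- replace ((z + h) ^ 1 - z ^ 1 - h * (NtoC 1 * z ^ 0)) with (RtoC 0)
    by (unfold NtoC; simpl; ring).
  rewrite Cmod_0; unfold r; simpl; nra.
- replace ((z + h) ^ S (S k) - z ^ S (S k) - h * (NtoC (S (S k)) * z ^ S k))
    with ((z + h) * ((z + h) ^ S k - z ^ S k - h * (NtoC (S k) * z ^ k))
          + h * h * (NtoC (S k) * z ^ k)).
  2: { unfold NtoC; rewrite (S_INR (S k)), RtoC_plus, !Cpow_S; ring. }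
  eapply Rle_trans; [apply Cmod_triangle|].
  rewrite !Cmod_mult, Cmod_pow; unfold NtoC at 2; rewrite Cmod_R, Rabs_pos_eq by apply pos_INR.
  set (e := Cmod (_ - _ - _)) in *.
  assert (Hzh : (Cmod (z + h) <= r)%R)
    by (eapply Rle_trans; [apply Cmod_triangle | unfold r; lra]).
  assert (Hp : (Cmod z ^ k <= r ^ S (S k))%R).
  { apply Rle_trans with (r ^ k)%R; [apply pow_incr; unfold r; lra|].
    apply Rle_pow; [unfold r; lra | lia]. }
  set (x := INR (S k)) in *; assert (Hx : (0 <= x)%R) by apply pos_INR.
  rewrite (S_INR (S k)); fold x.
  set (m := Cmod h) in *.
  assert (A1 : (Cmod (z + h) * e <= r * (m ^ 2 * (x ^ 2 * r ^ S k)))%R)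
    by (apply Rmult_le_compat; try apply Cmod_ge_0; assumption).
  assert (A2 : (m * m * (x * Cmod z ^ k) <= m * m * (x * r ^ S (S k)))%R).
  { apply Rmult_le_compat_l; [nra|]; now apply Rmult_le_compat_l. }
  assert (Hr : (0 <= r ^ S (S k))%R) by (apply pow_le; unfold r; lra).
  assert (A3 : (0 <= m * m * ((x + 1) * r ^ S (S k)))%R)
    by (apply Rmult_le_pos; [nra | apply Rmult_le_pos; lra]).
  replace (r ^ S (S k))%R with (r * r ^ S k)%R in * by reflexivity.
  nra.
Qed.

(** Summing [pow_taylor_le] against |c k| bounds the remainder by a multiple of
    |h|^2.  The radius 8 (|z| + 1) absorbs the factor k^2 <= 4^k and leaves a
    factor 2^(-k), which is summable. *)
Lemma is_derive_Cpseries (c : nat -> C) (z : C) :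
  entire_coef c ->
  is_derive (K := C_AbsRing) (V := C_NormedModule) (Cpseries c) z
    (Cpseries (fun k => NtoC (S k) * c (S k)) z).
Proof.
intro Hc.
assert (Hc' := entire_coef_derive c Hc).
set (f' := Cpseries _ z).
assert (HR := Cmod_ge_0 z).
destruct (Hc (8 * (Cmod z + 1))%R ltac:(lra)) as [M HM].
assert (HM0 : (0 <= M)%R).
{ eapply Rle_trans; [|apply (HM O)]; simpl; pose proof (Cmod_ge_0 (c O)); lra. }
assert (Hrem : forall h, (Cmod h <= 1)%R ->
  (Cmod (Cpseries c (z + h) - Cpseries c z - h * f') <= 2 * (Cmod h ^ 2 * M))%R).
{ intros h Hh.
  (* At k = 0 the factor NtoC k = 0 annihilates z ^ pred 0 = 1. *)
  set (e := fun k => c k * ((z + h) ^ k - z ^ k - h * (NtoC k * z ^ pred k))).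
  destruct (Cseries_dominated e (Cmod h ^ 2 * M)) as [l [Hl Hlb]].
  - intros [|k]; unfold e.
    + replace (c O * _) with (RtoC 0) by (unfold NtoC; simpl; ring).
      rewrite Cmod_0; simpl; pose proof (Cmod_ge_0 h); nra.
    + simpl pred; rewrite Cmod_mult.
      specialize (HM (S k)).
      apply Rle_trans with (Cmod (c (S k)) *
        (Cmod h ^ 2 * (INR (S k) ^ 2 * (Cmod z + 1) ^ S k)))%R.
      { apply Rmult_le_compat_l; [apply Cmod_ge_0 | now apply pow_taylor_le]. }
      replace (Cmod h ^ 2 * M * (/ 2) ^ S k)%R with (Cmod h ^ 2 * (M * (/ 2) ^ S k))%R by ring.
      replace (Cmod (c (S k)) * (Cmod h ^ 2 * (INR (S k) ^ 2 * (Cmod z + 1) ^ S k)))%R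
        with (Cmod h ^ 2 * (Cmod (c (S k)) * (INR (S k) ^ 2 * (Cmod z + 1) ^ S k)))%R by ring.
      apply Rmult_le_compat_l; [apply pow2_ge_0|].
      apply Rle_trans with (Cmod (c (S k)) * (8 * (Cmod z + 1)) ^ S k * (/ 2) ^ S k)%R.
      2: { apply Rmult_le_compat_r; [apply pow_le; lra | exact HM]. }
      rewrite !Rmult_assoc; apply Rmult_le_compat_l; [apply Cmod_ge_0|].
      rewrite <- Rpow_mult_distr.
      replace (8 * (Cmod z + 1) * / 2)%R with (2 * 2 * (Cmod z + 1))%R by field.
      rewrite !Rpow_mult_distr; apply Rmult_le_compat_r; [apply pow_le; lra|].
      pose proof (INR_le_pow2 (S k)); pose proof (pos_INR (S k)); nra.
  - replace (Cpseries c (z + h) - Cpseries c z - h * f') with l; [exact Hlb|].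
    apply (Cseries_unique e); [exact Hl|].
    assert (H0 : Cseries (fun k => c k * (NtoC k * z ^ pred k)) f').
    { replace f' with (f' + c O * (NtoC 0 * z ^ pred 0)) by (unfold NtoC; simpl; ring).
      apply (is_series_decr_1 (K := C_AbsRing) (V := C_NormedModule)).
      replace (plus _ _) with f'.
      - apply Cseries_ext with (fun k => (NtoC (S k) * c (S k)) * z ^ k).
        + intro k; simpl pred; ring.
        + now apply Cpseries_correct.
      - change (f' = f' + c O * (NtoC 0 * z ^ pred 0) + - (c O * (NtoC 0 * z ^ pred 0))); ring. }
    assert (H1 := Cpseries_correct c (z + h) Hc).
    assert (H2 := Cseries_scal (- (1)) _ _ (Cpseries_correct c z Hc)).
    assert (H3 := Cseries_scal (- h) _ _ H0).
    replace (Cpseries c (z + h) - Cpseries c z - h * f')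
      with (Cpseries c (z + h) + - (1) * Cpseries c z + - h * f') by ring.
    eapply Cseries_ext; [|exact (Cseries_plus _ _ _ _ (Cseries_plus _ _ _ _ H1 H2) H3)].
    intro k; unfold e; simpl; ring. }
split; [apply is_linear_scal_l|].
intros x Hx.
apply (is_filter_lim_locally_unique (V := AbsRing_NormedModule C_AbsRing)) in Hx; subst x.
intros [eps He].
assert (Hd : (0 < Rmin 1 (eps / (2 * (M + 1))))%R).
{ apply Rmin_pos; [lra | apply Rdiv_lt_0_compat; lra]. }
exists (mkposreal _ Hd); intros y Hy.
change (Cmod (y - z) < Rmin 1 (eps / (2 * (M + 1))))%R in Hy.
change (Cmod (Cpseries c y - Cpseries c z - (y - z) * f') <= eps * Cmod (y - z))%R.
set (h := y - z) in *.
replace y with (z + h) by (unfold h; ring).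
assert (Hh0 := Cmod_ge_0 h).
assert (B1 := Rmin_l 1 (eps / (2 * (M + 1)))); assert (B2 := Rmin_r 1 (eps / (2 * (M + 1)))).
eapply Rle_trans; [apply Hrem; lra|].
assert (B3 : (Cmod h * (2 * (M + 1)) <= eps)%R).
{ replace eps with (eps / (2 * (M + 1)) * (2 * (M + 1)))%R by (field; lra).
  apply Rmult_le_compat_r; lra. }
nra.
Qed.

(** The coefficients of the n-th derivative: (k+n)(k+n-1) ... (k+1) c_(k+n). *)
Definition derive_coef (n : nat) (c : nat -> C) (k : nat) : C :=
  falling (NtoC (n + k)) n * c (n + k)%nat.

Lemma derive_coef_S (n : nat) (c : nat -> C) (k : nat) :
  NtoC (S k) * derive_coef n c (S k) = derive_coef (S n) c k.
Proof.
unfold derive_coef.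
change (falling (NtoC (S n + k)) (S n))
  with (falling (NtoC (S n + k)) n * (NtoC (S n + k) - NtoC n)).
replace (n + S k)%nat with (S n + k)%nat by lia.
replace (NtoC (S n + k) - NtoC n) with (NtoC (S k)); [ring|].
unfold NtoC; rewrite <- RtoC_minus; f_equal.
replace (S n + k)%nat with (n + S k)%nat by lia; rewrite plus_INR; ring.
Qed.

Lemma entire_coef_ext (c d : nat -> C) :
  (forall k, c k = d k) -> entire_coef c -> entire_coef d.
Proof.
intros H Hc r Hr; destruct (Hc r Hr) as [M HM]; exists M; intro k; now rewrite <- H.
Qed.

Lemma Cpseries_ext (c d : nat -> C) (z : C) :
  (forall k, c k = d k) -> entire_coef d -> Cpseries c z = Cpseries d z.
Proof.
intros H Hd; apply Cpseries_unique.
apply Cseries_ext with (fun k => d k * z ^ k); [|now apply Cpseries_correct].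
intro k; now rewrite H.
Qed.

Lemma derive_coef_0 (c : nat -> C) (k : nat) : derive_coef 0 c k = c k.
Proof. unfold derive_coef, falling; simpl; ring. Qed.

Lemma entire_derive_coef (n : nat) (c : nat -> C) :
  entire_coef c -> entire_coef (derive_coef n c).
Proof.
intro Hc; induction n as [|n IH].
- apply entire_coef_ext with c; [|exact Hc]; intro k; symmetry; apply derive_coef_0.
- eapply entire_coef_ext; [|exact (entire_coef_derive _ IH)].
  intro k; apply derive_coef_S.
Qed.

Lemma is_C_derive_n_Cpseries (c : nat -> C) (n : nat) (z : C) :
  entire_coef c -> is_C_derive_n (Cpseries c) n z (Cpseries (derive_coef n c) z).
Proof.
intro Hc; revert z; induction n as [|n IH]; intro z.
- simpl; symmetry; apply Cpseries_ext; [apply derive_coef_0 | exact Hc].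
- exists (Cpseries (derive_coef n c)); split; [now apply filter_forall|].
  rewrite <- (Cpseries_ext _ (derive_coef (S n) c) z (derive_coef_S n c))
    by now apply entire_derive_coef.
  now apply is_derive_Cpseries, entire_derive_coef.
Qed.

(** * Decay of the Mittag-Leffler coefficients *)

Lemma bounded_of_eventually_decreasing (u : nat -> R) (K : nat) :
  (forall k, (K <= k)%nat -> (u (S k) <= u k)%R) -> exists M, forall k, (u k <= M)%R.
Proof.
revert u; induction K as [|K IH]; intros u H.
- exists (u O); induction k as [|k IHk]; [lra|].
  eapply Rle_trans; [apply H; lia | exact IHk].
- destruct (IH (fun k => u (S k))) as [M HM].
  + intros k Hk; apply H; lia.
  + exists (Rmax (u O) M); intros [|k]; [apply Rmax_l|].
    eapply Rle_trans; [apply HM | apply Rmax_r].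
Qed.

(** A form of the ratio test that tolerates vanishing coefficients, as happens here
    when b + a k is a pole of Gamma. *)
Lemma entire_coef_of_ratio (c : nat -> C) :
  (forall eps, (0 < eps)%R -> exists K, forall k, (K <= k)%nat ->
     (Cmod (c (S k)) <= eps * Cmod (c k))%R) ->
  entire_coef c.
Proof.
intros H r Hr.
destruct (H (/ (r + 1))%R) as [K HK]; [apply Rinv_0_lt_compat; lra|].
apply (bounded_of_eventually_decreasing (fun k => Cmod (c k) * r ^ k)%R K).
intros k Hk; specialize (HK k Hk).
assert (Hp : (0 <= r ^ k)%R) by now apply pow_le.
assert (Hc := Cmod_ge_0 (c k)).
assert (Hq : (/ (r + 1) * r <= 1)%R).
{ apply Rmult_le_reg_l with (r + 1)%R; [lra|].
  rewrite <- Rmult_assoc, Rinv_r by lra; lra. }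
apply Rle_trans with (/ (r + 1) * Cmod (c k) * r ^ S k)%R.
- apply Rmult_le_compat_r; [now apply pow_le | exact HK].
- simpl.
  replace (/ (r + 1) * Cmod (c k) * (r * r ^ k))%R
    with ((/ (r + 1) * r) * (Cmod (c k) * r ^ k))%R by ring.
  assert (0 <= Cmod (c k) * r ^ k)%R by now apply Rmult_le_pos.
  nra.
Qed.

(** The points b + a k eventually lie in the sector |Im z| <= c Re z, and the real
    part exceeds any x0 for k large, so [rGamma_add_le] makes the ratio of
    consecutive coefficients arbitrarily small. *)
Lemma entire_coef_Mittag_Leffler (a b : C) : (0 < Re a)%R ->
  entire_coef (fun k => rGamma (b + a * NtoC k)).
Proof.
intro Ha; apply entire_coef_of_ratio; intros eps He.
(* c comes from k = (Re z - Re b) / al, for Re z >= 1. *)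
set (al := Re a) in *; set (c := (Rabs (Im b) + Rabs (Im a) / al * (1 + Rabs (Re b)))%R).
set (D := (2 * Rabs (Im a) * c + Cmod a ^ 2)%R).
(* x0 solves al * (1 + ln 2 - ln x0) + D = ln eps. *)
set (x0 := exp (1 + ln 2 + (D - ln eps) / al)).
destruct (nfloor_ex ((1 + x0 + Rabs (Re b)) / al)%R) as [K [_ HK]].
{ unfold x0; pose proof (exp_pos (1 + ln 2 + (D - ln eps) / al)).
  pose proof (Rabs_pos (Re b)); apply Rlt_le, Rdiv_lt_0_compat; lra. }
exists (S K); intros k Hk.
set (z := b + a * NtoC k).
replace (b + a * NtoC (S k)) with (z + a)
  by (unfold z, NtoC; rewrite S_INR, RtoC_plus; ring).
assert (Hre : Re z = (Re b + INR k * al)%R).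
{ unfold z, NtoC, al; rewrite re_plus, re_scal_r; ring. }
assert (Him : Im z = (Im b + INR k * Im a)%R).
{ unfold z, NtoC; rewrite im_plus, im_scal_r; ring. }
assert (Hkx : (1 + x0 + Rabs (Re b) <= INR k * al)%R).
{ apply Rle_trans with ((1 + x0 + Rabs (Re b)) / al * al)%R; [right; field; lra|].
  apply Rmult_le_compat_r; [lra|].
  apply le_INR in Hk; rewrite S_INR in Hk; lra. }
assert (Hb := Rabs_pos (Re b)); assert (Hb' := Rle_abs (- Re b)); rewrite Rabs_Ropp in Hb'.
assert (Hb'' := Rle_abs (Re b)).
assert (Hx0 : (0 < x0)%R) by apply exp_pos.
assert (Hx : (1 <= Re z)%R) by lra.
assert (Hxx : (x0 <= Re z)%R) by lra.
assert (Hc : (Rabs (Im z) <= c * Re z)%R).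
{ rewrite Him; eapply Rle_trans; [apply Rabs_triang|].
  rewrite Rabs_mult, (Rabs_pos_eq (INR k)) by apply pos_INR.
  assert (B1 : (Rabs (Im b) <= Rabs (Im b) * Re z)%R)
    by (pose proof (Rabs_pos (Im b)); nra).
  assert (B2 : (INR k * Rabs (Im a) <= Rabs (Im a) / al * ((1 + Rabs (Re b)) * Re z))%R).
  { replace (INR k * Rabs (Im a))%R with (Rabs (Im a) / al * (INR k * al))%R by (field; lra).
    apply Rmult_le_compat_l.
    - apply Rmult_le_pos; [apply Rabs_pos | left; now apply Rinv_0_lt_compat].
    - rewrite <- (Rplus_minus_l (Re b) (INR k * al)), <- Hre; nra. }
  unfold c; lra. }
eapply Rle_trans; [apply (rGamma_add_le z a c Ha Hx Hc)|].
fold D; fold al.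
apply Rmult_le_compat_r; [apply Cmod_ge_0|].
assert (Hln : (1 + ln 2 + (D - ln eps) / al <= ln (Re z))%R).
{ unfold x0 in Hxx; rewrite <- (ln_exp (1 + ln 2 + (D - ln eps) / al)).
  now apply ln_le; [apply exp_pos|]. }
apply Rmult_le_compat_l with (r := al) in Hln; [|lra].
replace (al * (1 + ln 2 + (D - ln eps) / al))%R
  with (al * (1 + ln 2) + (D - ln eps))%R in Hln by (field; lra).
rewrite <- (exp_ln eps He).
apply exp_le_mono; lra.
Qed.

(** * Falling factorials and Stirling numbers *)

Lemma falling_S (x : C) (n : nat) : falling x (S n) = falling x n * (x - NtoC n).
Proof. reflexivity. Qed.

Lemma falling_mult_rGamma (z : C) (l : nat) :
  falling (z - 1) l * rGamma z = rGamma (z - NtoC l).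
Proof.
induction l as [|l IH].
- replace (z - NtoC 0) with z by (unfold NtoC; simpl; ring).
  unfold falling; simpl; ring.
- rewrite falling_S.
  replace (falling (z - 1) l * (z - 1 - NtoC l) * rGamma z)
    with ((z - NtoC l - 1) * (falling (z - 1) l * rGamma z)) by ring.
  rewrite IH, <- rGamma_pred; f_equal.
  unfold NtoC; rewrite S_INR, RtoC_plus; ring.
Qed.

Lemma Csum_ext (f g : nat -> C) (m n : nat) :
  (forall k, (m <= k <= n)%nat -> f k = g k) -> Csum f m n = Csum g m n.
Proof. apply sum_n_m_ext_loc. Qed.

Lemma Csum_plus (f g : nat -> C) (m n : nat) :
  Csum (fun k => f k + g k) m n = Csum f m n + Csum g m n.
Proof. exact (sum_n_m_plus (G := C_AbelianMonoid) f g m n). Qed.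

Lemma Csum_mult_l (c : C) (f : nat -> C) (m n : nat) :
  Csum (fun k => c * f k) m n = c * Csum f m n.
Proof. exact (sum_n_m_mult_l (K := C_Ring) c f m n). Qed.

Lemma Csum_mult_r (c : C) (f : nat -> C) (m n : nat) :
  Csum (fun k => f k * c) m n = Csum f m n * c.
Proof. exact (sum_n_m_mult_r (K := C_Ring) c f m n). Qed.

Lemma Csum_first (f : nat -> C) (n : nat) :
  Csum f 0 (S n) = f O + Csum (fun k => f (S k)) 0 n.
Proof.
unfold Csum; rewrite sum_Sn_m by lia.
rewrite <- sum_n_m_S; reflexivity.
Qed.

Lemma Csum_triangle (F : nat -> nat -> C) (j : nat) :
  Csum (fun q => Csum (fun m => F q m) 0 q) 0 j =
  Csum (fun m => Csum (fun q => F q m) m j) 0 j.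
Proof.
induction j as [|j IH].
- now rewrite !Csum_0.
- rewrite Csum_last, IH.
  rewrite (Csum_ext (fun m => Csum (fun q => F q m) m (S j))
             (fun m => Csum (fun q => F q m) m j + F (S j) m)).
  + rewrite Csum_plus; f_equal.
    rewrite Csum_last.
    replace (Csum (fun q => F q (S j)) (S j) j) with (RtoC 0); [ring|].
    symmetry; apply (sum_n_m_zero (G := C_AbelianMonoid)); lia.
  + intros m Hm; unfold Csum; rewrite sum_n_Sm by lia; reflexivity.
Qed.

(** The binomial coefficient x(x-1) ... (x-n+1) / n!.  In this normalization the
    Chu-Vandermonde identity is a convolution, and the two-term rule [Cbinom_S]
    suffices to prove it by induction. *)
Definition Cbinom (x : C) (n : nat) : C := falling x n / NtoC (fact n).

Lemma NtoC_S_neq_0 (n : nat) : NtoC (S n) <> 0.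
Proof. intro E; apply RtoC_inj in E; revert E; apply not_0_INR; lia. Qed.

Lemma NtoC_fact_neq_0 (n : nat) : NtoC (fact n) <> 0.
Proof. intro E; apply RtoC_inj in E; revert E; apply INR_fact_neq_0. Qed.

Lemma Cbinom_S (x : C) (n : nat) :
  NtoC (S n) * Cbinom x (S n) = (x - NtoC n) * Cbinom x n.
Proof.
unfold Cbinom; rewrite falling_S, fact_simpl.
replace (NtoC (S n * fact n)) with (NtoC (S n) * NtoC (fact n))
  by (unfold NtoC; now rewrite mult_INR, RtoC_mult).
field; split; [apply NtoC_fact_neq_0 | apply NtoC_S_neq_0].
Qed.

(** Multiply by n+1: on the left use (n+1) Cbinom t (n+1) = (t - n) Cbinom t n with
    t = x + y; on the right write n+1 = l + (n+1-l), and absorb l into the first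
    factor and n+1-l into the second by the same rule. *)
Lemma Cbinom_vandermonde (x y : C) (n : nat) :
  Cbinom (x + y) n = Csum (fun l => Cbinom x l * Cbinom y (n - l)) 0 n.
Proof.
induction n as [|n IH].
- rewrite Csum_0; unfold Cbinom, falling, NtoC; simpl; field.
- assert (Hn := NtoC_S_neq_0 n).
  replace (Cbinom (x + y) (S n)) with (/ NtoC (S n) * (NtoC (S n) * Cbinom (x + y) (S n)))
    by (field; exact Hn).
  rewrite Cbinom_S, IH, <- Csum_mult_l.
  rewrite (Csum_ext _ (fun l => (NtoC (S l) * Cbinom x (S l)) * Cbinom y (n - l)
                     + Cbinom x l * (NtoC (S n - l) * Cbinom y (S n - l)))).
  2: { intros l Hl; replace (S n - l)%nat with (S (n - l)) by lia.
       rewrite !Cbinom_S.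
       replace (NtoC n) with (NtoC l + NtoC (n - l)).
       - ring.
       - unfold NtoC; rewrite <- RtoC_plus, <- plus_INR; do 2 f_equal; lia. }
  rewrite Csum_plus.
  set (T := fun l => Cbinom x l * Cbinom y (S n - l)).
  assert (E1 : Csum (fun l => NtoC (S l) * Cbinom x (S l) * Cbinom y (n - l)) 0 n
             = Csum (fun l => NtoC l * T l) 0 (S n)).
  { rewrite Csum_first; unfold T.
    rewrite (Csum_ext (fun k => NtoC (S k) * _)
               (fun l => NtoC (S l) * Cbinom x (S l) * Cbinom y (n - l))).
    - unfold NtoC at 2; simpl; ring.
    - intros k _; simpl (S n - S k)%nat; ring. }
  assert (E2 : Csum (fun l => Cbinom x l * (NtoC (S n - l) * Cbinom y (S n - l))) 0 n
             = Csum (fun l => NtoC (S n - l) * T l) 0 (S n)).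
  { rewrite Csum_last; unfold T; rewrite Nat.sub_diag.
    rewrite (Csum_ext (fun k => NtoC (S n - k) * _)
               (fun l => Cbinom x l * (NtoC (S n - l) * Cbinom y (S n - l)))).
    - unfold NtoC at 3; simpl; ring.
    - intros k _; ring. }
  rewrite E1, E2, <- Csum_plus.
  rewrite (Csum_ext _ (fun l => NtoC (S n) * T l)).
  + rewrite Csum_mult_l; field; exact Hn.
  + intros l Hl.
    replace (NtoC (S n)) with (NtoC l + NtoC (S n - l)); [ring|].
    unfold NtoC; rewrite <- RtoC_plus, <- plus_INR; do 2 f_equal; lia.
Qed.

Lemma falling_vandermonde (x y : C) (n : nat) :
  falling (x + y) n =
  Csum (fun l => RtoC (Binomial.C n l) * falling y (n - l) * falling x l) 0 n.
Proof.
assert (Hn := NtoC_fact_neq_0 n).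
replace (falling (x + y) n) with (NtoC (fact n) * Cbinom (x + y) n)
  by (unfold Cbinom; field; exact Hn).
rewrite Cbinom_vandermonde, <- Csum_mult_l; apply Csum_ext; intros l Hl.
unfold Cbinom, Binomial.C.
assert (INR (fact l) <> 0%R) by apply INR_fact_neq_0.
assert (INR (fact (n - l)) <> 0%R) by apply INR_fact_neq_0.
rewrite RtoC_div, RtoC_mult by now apply Rmult_integral_contrapositive_currified.
change (RtoC (INR ?k)) with (NtoC k).
field; split; apply NtoC_fact_neq_0.
Qed.

(** Expand k(k-1) ... (k-j+1) in powers of k, these in falling factorials of a k,
    and these by Chu-Vandermonde at (b + a k - 1) + (1 - b); two exchanges of
    triangular sums put the shift l outermost. *)
Lemma coef_expansion (S1 S2 : nat -> nat -> Z)
    (HS1 : is_stirling1 S1) (HS2 : is_stirling2 S2) (a b : C) (Ha : a <> 0) (j k : nat) :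
  falling (NtoC k) j * rGamma (b + a * NtoC k) =
  Csum (fun l =>
    Csum (fun m =>
      RtoC (Binomial.C m l) * falling (1 - b) (m - l) *
      Csum (fun q => ZtoC (S1 j q) * ZtoC (S2 q m) * (1 / a ^ q)) m j) l j
    * rGamma ((b - NtoC l) + a * NtoC k)) 0 j.
Proof.
set (z := b + a * NtoC k).
set (w := fun q m => ZtoC (S1 j q) * ZtoC (S2 q m) * (1 / a ^ q)).
set (v := fun m l => RtoC (Binomial.C m l) * falling (1 - b) (m - l)).
assert (HV : forall m, falling (a * NtoC k) m * rGamma z =
               Csum (fun l => v m l * rGamma (z - NtoC l)) 0 m).
{ intro m; replace (a * NtoC k) with ((z - 1) + (1 - b)) by (unfold z; ring).
  rewrite falling_vandermonde, <- Csum_mult_r; apply Csum_ext; intros l _.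
  rewrite <- falling_mult_rGamma; unfold v; ring. }
rewrite HS1, <- Csum_mult_r.
rewrite (Csum_ext _ (fun q => Csum (fun m => w q m * (falling (a * NtoC k) m * rGamma z)) 0 q)).
2: { intros q _.
     (* Rescaling the variable by a is what brings in the powers 1 / a^q. *)
     replace (NtoC k ^ q) with ((a * NtoC k) ^ q / a ^ q).
     - rewrite HS2; unfold Cdiv.
       rewrite <- Csum_mult_r, <- Csum_mult_l, <- Csum_mult_r; apply Csum_ext; intros m _.
       unfold w, Cdiv; ring.
     - rewrite Cpow_mult_l; field; now apply Cpow_nz. }
rewrite Csum_triangle.
rewrite (Csum_ext _ (fun m => Csum (fun l => Csum (fun q => w q m) m j *
                                 (v m l * rGamma (z - NtoC l))) 0 m)).
2: { intros m _; rewrite Csum_mult_r, HV, <- Csum_mult_l; reflexivity. }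
rewrite Csum_triangle; apply Csum_ext; intros l _.
replace (b - NtoC l + a * NtoC k) with (z - NtoC l) by (unfold z; ring).
rewrite <- Csum_mult_r; apply Csum_ext; intros m _.
unfold v, w; ring.
Qed.

(** * The derivatives of the Mittag-Leffler function *)

Lemma Cseries_drop (u : nat -> C) (l : C) (n : nat) :
  (forall k, (k < n)%nat -> u k = 0) -> Cseries u l -> Cseries (fun k => u (n + k)%nat) l.
Proof.
revert u; induction n as [|n IH]; intros u H0 H; [exact H|].
apply (IH (fun k => u (S k))); [intros k Hk; apply H0; lia|].
apply (is_series_incr_1 (K := C_AbsRing) (V := C_NormedModule)).
(* The sum of the remaining terms is l minus u 0, and u 0 = 0. *)
replace l with (l + u O) in H by (rewrite H0 by lia; ring).
exact H.
Qed.

Lemma falling_NtoC_lt (k n : nat) : (k < n)%nat -> falling (NtoC k) n = 0.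
Proof.
induction n as [|n IH]; intro H; [lia|].
rewrite falling_S; destruct (Nat.eq_dec k n) as [->|Hne].
- replace (NtoC n - NtoC n) with (RtoC 0) by ring; ring.
- rewrite IH by lia; ring.
Qed.

(** The first n terms of the given series vanish; dropping them and dividing by z^n
    leaves the series of the n-th derivative. *)
Lemma Cpseries_derive_coef (c : nat -> C) (n : nat) (z l : C) : z <> 0 ->
  Cseries (fun k => falling (NtoC k) n * c k * z ^ k) l ->
  Cpseries (derive_coef n c) z = / (z ^ n) * l.
Proof.
intros Hz H; apply Cpseries_unique.
apply (Cseries_drop _ _ n), (Cseries_scal (/ (z ^ n))) in H.
- revert H; apply Cseries_ext; intro k; unfold derive_coef.
  rewrite Cpow_add_r; field; now apply Cpow_nz.
- intros k Hk; rewrite falling_NtoC_lt by exact Hk; ring.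
Qed.

Theorem mainTheorem3 (S1 S2 : nat -> nat -> Z)
    (HS1 : is_stirling1 S1) (HS2 : is_stirling2 S2)
    (a b w : C) (Ha : (0 < Re a)%R) (Hw : w <> 0) (j : nat) :
  is_C_derive_n (Mittag_Leffler a b) j w
    (/ (w ^ j) *
     Csum (fun k =>
       Mittag_Leffler a (b - NtoC k) w *
       Csum (fun m =>
         RtoC (Binomial.C m k) * falling (1 - b) (m - k) *
         Csum (fun q => ZtoC (S1 j q) * ZtoC (S2 q m) * (1 / a ^ q)) m j)
         k j)
       0 j).
Proof.
assert (Ha0 : a <> 0) by (intros ->; simpl in Ha; lra).
set (A := fun l => Csum (fun m => RtoC (Binomial.C m l) * falling (1 - b) (m - l) *
       Csum (fun q => ZtoC (S1 j q) * ZtoC (S2 q m) * (1 / a ^ q)) m j) l j).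
rewrite <- (Cpseries_derive_coef (fun k => rGamma (b + a * NtoC k)) j w); [| exact Hw |].
- exact (is_C_derive_n_Cpseries _ j w (entire_coef_Mittag_Leffler a b Ha)).
- apply Cseries_ext with (fun k =>
    Csum (fun l => A l * (rGamma (b - NtoC l + a * NtoC k) * w ^ k)) 0 j).
  + intro k; rewrite (coef_expansion S1 S2 HS1 HS2) by exact Ha0.
    rewrite <- Csum_mult_r; apply Csum_ext; intros l _; unfold A; ring.
  + apply Cseries_Csum; intro l.
    rewrite Cmult_comm; apply Cseries_scal.
    exact (Cpseries_correct _ w (entire_coef_Mittag_Leffler a (b - NtoC l) Ha)).
Qed.
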